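(* Let $\mathcal C$ be a braided unital monoidal Ab-category, $(A,m,\eta,\sigma)$ a ribbon algebra in $\mathcal C$, $\Omega$ a (not necessarily ribbon) differential calculus of degree $n$, $0\le n<\infty$, on $A$ in $\mathcal C$, and $\int:\Omega_n\to\mathbf 1$ a closed weak ribbon graded trace on $\Omega$. Define the morphism of $\bar{\mathcal C}$ $$\varphi:A^{\otimes(n+1)}\to\mathbf 1,\qquad \varphi=\int m(\mathrm{id}\otimes d^{\otimes n}),$$ where here $m:A\otimes\Omega_1^{\otimes n}\to\Omega_n$ is the morphism induced by the multiplication morphisms of $\Omega$ (using associativity) and $d=d_0:A\to\Omega_1$. Then $\varphi$ is a braided cyclic cocycle, i.e. $\varphi\in Z^n_\lambda(\mathcal C;A,\sigma)$.
   Context: Braided monoidal Ab-category: a category $\mathcal C$ with a functor $\otimes:\mathcal C\times\mathcal C\to\mathcal C$, natural isomorphisms $\Phi_{U,V,W}:U\otimes(V\otimes W)\to(U\otimes V)\otimes W$ (pentagon identity) and $\Psi_{U,V}:U\otimes V\to V\otimes U$ (two hexagon identities), and a unit object $\mathbf 1$. It is assumed that $U\otimes\mathbf 1=\mathbf 1\otimes U=U$, that $\Phi_{U,V,W}=\mathrm{id}$ when one of $U,V,W$ is $\mathbf 1$, and similarly $\Psi_{U,\mathbf 1}=\Psi_{\mathbf 1,U}=\mathrm{id}$. All $\mathrm{Hom}(U,V)$ are abelian groups with composition and tensor product of morphisms bilinear. Standing assumption: the tensor product of two epimorphisms in $\mathcal C$ is an epimorphism. Bracketings: $\Lambda_1=\{\mathrm{id}\}$,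 $\Lambda_2=\{\otimes\}$, and for $n>2$, $\Lambda_n$ is the set of pairs $(\alpha,\beta)$ with $\alpha\in\Lambda_k,\beta\in\Lambda_l$, $k,l<n$, $k+l=n$. For $\alpha\in\Lambda_n$, $(U_1\otimes\cdots\otimes U_n;\alpha)$ is the object of $\mathcal C$ obtained by bracketing the $n$-fold tensor product according to $\alpha$; thus the object for $(\alpha,\beta)$ is $(U_1\otimes\cdots\otimes U_k;\alpha)\otimes(U_{k+1}\otimes\cdots\otimes U_n;\beta)$. By Mac Lane's coherence theorem there is a unique family of isomorphisms $I^\alpha_\beta(U_1,\dots,U_m):(U_1\otimes\cdots\otimes U_m;\alpha)\to(U_1\otimes\cdots\otimes U_m;\beta)$ with $I^\alpha_\beta=\mathrm{id}$ for $m=1,2$, $I^\beta_\gamma I^\alpha_\beta=I^\alpha_\gamma$, $I^{\alpha_1}_{\alpha_2}\otimes I^{\beta_1}_{\beta_2}=I^{(\alpha_1,\beta_1)}_{(\alpha_2,\beta_2)}$ and $I^{(\mathrm{id},\otimes)}_{(\otimes,\mathrm{id})}=\Phi$. Strict extension $\bar{\mathcal C}$: objects are formal words $U_1\otimes\cdots\otimes U_n$, $n\ge1$, of objects of $\mathcal C$, where $U_i\neq\mathbf 1$ for all $i$ if $n>1$. Morphisms $U_1\otimes\cdots\otimes U_m\to V_1\otimes\cdots\otimes V_n$ are equivalence classes $[f]$ of morphisms $f:(U_1\otimes\cdots\otimes U_m;\alpha)\to(V_1\otimes\cdots\otimes V_n;\beta)$ of $\mathcal C$ ($\alpha\in\Lambda_m,\beta\in\Lambda_n$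 arbitrary), where $f_1\sim f_2$ iff $f_2=I^{\beta_1}_{\beta_2}f_1I^{\alpha_2}_{\alpha_1}$. Each class has exactly one representative $f^\alpha_\beta$ for each $(\alpha,\beta)$. Composition: $gf=[g^\beta_\gamma f^\alpha_\beta]$; sum: $[f^\alpha_\beta+g^\alpha_\beta]$. The tensor product of objects is concatenation of words, with $\mathbf 1$ as strict unit; $f\otimes f'=[f^\alpha_\beta\otimes f'^{\alpha'}_{\beta'}]$ regarded as a morphism with bracketings $(\alpha,\alpha')$, $(\beta,\beta')$. The braiding of $\bar{\mathcal C}$ (also written $\Psi$) between $U_1\otimes\cdots\otimes U_m$ and $V_1\otimes\cdots\otimes V_n$ is the class of $\Psi_{(U_1\otimes\cdots\otimes U_m;\alpha),(V_1\otimes\cdots\otimes V_n;\beta)}$. With this $\bar{\mathcal C}$ is a strict braided monoidal Ab-category, and all identities below are in $\bar{\mathcal C}$. An algebra in $\mathcal C$ is an object $A$ of $\mathcal C$ with morphisms $m:A\otimes A\to A$, $\eta:\mathbf 1\to A$ such that $m(\mathrm{id}\otimes m)=m(m\otimes\mathrm{id})$ and $m(\mathrm{id}\otimes\eta)=m(\eta\otimes\mathrm{id})=\mathrm{id}$. A ribbon algebra is an algebra with an automorphism $\sigma:A\to A$ (of the object $A$) such that $m(\sigma\otimes\sigma)\Psi_{A,A}\Psi_{A,A}=\sigma m$ and $\sigma\eta=\eta$. Braided cyclic cocycles: with $\mathrm{id}_k=\mathrm{id}_{A^{\otimes k}}$, define on $A^{\otimes(n+1)}$ the morphisms $d_i^{(n)}=\mathrm{id}_i\otimes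 m\otimes\mathrm{id}_{n-1-i}$ ($0\le i\le n-1$), $d_n^{(n)}=(m\otimes\mathrm{id}_{n-1})(\sigma\otimes\mathrm{id}_n)\Psi_{A^{\otimes n},A}$ (to $A^{\otimes n}$, $n\ge1$), and $\lambda_n=(-1)^n(\sigma\otimes\mathrm{id}_n)\Psi_{A^{\otimes n},A}:A^{\otimes(n+1)}\to A^{\otimes(n+1)}$. Let $C^n_\lambda(\mathcal C;A,\sigma)=\{\varphi\in\mathrm{Hom}_{\bar{\mathcal C}}(A^{\otimes(n+1)},\mathbf 1)\mid\varphi\lambda_n=\varphi\}$. The Hochschild coboundary of $\varphi\in\mathrm{Hom}_{\bar{\mathcal C}}(A^{\otimes(n+1)},\mathbf 1)$ is $\sum_{i=0}^{n+1}(-1)^i\varphi\, d_i^{(n+1)}$. $Z^n_\lambda(\mathcal C;A,\sigma)$ is the set of $\varphi\in C^n_\lambda(\mathcal C;A,\sigma)$ with zero Hochschild coboundary. Differential calculus (DC) of degree $n$ over $(A,m,\eta)$ in $\mathcal C$: objects $\Omega_0=A,\Omega_1,\dots,\Omega_n$ of $\mathcal C$ with morphisms $m_{i,j}:\Omega_i\otimes\Omega_j\to\Omega_{i+j}$, $m_{0,0}=m$, and $d_i:\Omega_i\to\Omega_{i+1}$ (everything of degree $>n$ being zero), such that the $m_{i,j}$ are associative and unital with respect to $\eta$, $d_{i+1}d_i=0$, the graded Leibniz rule $d\,m_{i,j}=m_{i+1,j}(d\otimes\mathrm{id})+(-1)^im_{i,j+1}(\mathrm{id}\otimes d)$ holds,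 and for each $1\le k\le n$ the morphism $m_{0,k-1+1}(\mathrm{id}\otimes d):A\otimes\Omega_{k-1}\to\Omega_k$ is an epimorphism. A weak ribbon graded trace on $\Omega$ is a morphism $\int:\Omega_n\to\mathbf 1$ with $\int m_{n,0}=\int m_{0,n}(\sigma\otimes\mathrm{id}_{\Omega_n})\Psi_{\Omega_n,A}$. It is closed if $\int d_{n-1}=0$. *)

(* Defs.v *)
From HB Require Import structures.
From mathcomp Require Import all_boot all_order all_algebra.
From mathcomp Require Import boolp.

Set Implicit Arguments.
Unset Strict Implicit.
Unset Printing Implicit Defensive.

Import GRing.Theory.
Local Open Scope ring_scope.

Declare Scope cat_scope.
Delimit Scope cat_scope with C.
Declare Scope bar_scope.
Delimit Scope bar_scope with B.

Reserved Notation "U ⊗ V" (at level 40, left associativity).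
Reserved Notation "f ⊠ g" (at level 40, left associativity).
Reserved Notation "g ∘ f" (at level 45, left associativity).

Record catData := CatData {
  Ob :> Type;
  mor : Ob -> Ob -> zmodType;
  idm : forall U, mor U U;
  mcomp : forall U V W, mor V W -> mor U V -> mor U W;
  tens : Ob -> Ob -> Ob;
  tensm : forall U U' V V', mor U U' -> mor V V' ->
    mor (tens U V) (tens U' V');
  unit_ob : Ob;
  Phi : forall U V W, mor (tens U (tens V W)) (tens (tens U V) W);
  Phi_inv : forall U V W, mor (tens (tens U V) W) (tens U (tens V W));
  Psi : forall U V, mor (tens U V) (tens V U);
  Psi_inv : forall U V, mor (tens V U) (tens U V);
}.

Arguments mor {c}.
Arguments idm {c}.
Arguments mcomp {c U V W}.
Arguments tens {c}.
Arguments tensm {c U U' V V'}.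
Arguments unit_ob {c}.
Arguments Phi {c}.
Arguments Phi_inv {c}.
Arguments Psi {c}.
Arguments Psi_inv {c}.

Bind Scope cat_scope with Ob.
Notation "U ⊗ V" := (tens U V) : cat_scope.
Notation "f ⊠ g" := (tensm f g) : cat_scope.
Notation "g ∘ f" := (mcomp g f) : cat_scope.
Local Open Scope cat_scope.

Definition epi (C : catData) (U V : C) (f : mor U V) : Prop :=
  forall W (g h : mor V W), g ∘ f = h ∘ f -> g = h.

(* The identity morphism between two equal objects, e.g. U ⊗ 1 and U. *)
Definition eqhom (C : catData) (U V : C) (e : U = V) : mor U V :=
  match e in _ = V' return mor U V' with erefl => idm U end.

(* U ⊗ 1 = U = 1 ⊗ U is an equality of functors in U: tensU1 and tens1U on
   objects, tensm_id1 and id1_tensm on morphisms. In Phi_1l, ..., Psi_1l the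
   equality e is a consequence of tensU1 and tens1U. *)
Record braidedLaws (C : catData) : Prop := BraidedLaws {
  comp1m : forall (U V : C) (f : mor U V), idm V ∘ f = f;
  compm1 : forall (U V : C) (f : mor U V), f ∘ idm U = f;
  compA : forall (U V W X : C) (h : mor W X) (g : mor V W) (f : mor U V),
    h ∘ (g ∘ f) = h ∘ g ∘ f;
  compDl : forall (U V W : C) (g g' : mor V W) (f : mor U V),
    (g + g') ∘ f = g ∘ f + g' ∘ f;
  compDr : forall (U V W : C) (g : mor V W) (f f' : mor U V),
    g ∘ (f + f') = g ∘ f + g ∘ f';
  tens11 : forall U V : C, idm U ⊠ idm V = idm (U ⊗ V);
  tens_comp : forall (U U' U'' V V' V'' : C) (f' : mor U' U'') (f : mor U U')
      (g' : mor V' V'') (g : mor V V'),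
    (f' ∘ f) ⊠ (g' ∘ g) = (f' ⊠ g') ∘ (f ⊠ g);
  tensDl : forall (U U' V V' : C) (f f' : mor U U') (g : mor V V'),
    (f + f') ⊠ g = f ⊠ g + f' ⊠ g;
  tensDr : forall (U U' V V' : C) (f : mor U U') (g g' : mor V V'),
    f ⊠ (g + g') = f ⊠ g + f ⊠ g';
  tensU1 : forall U : C, U ⊗ unit_ob = U;
  tens1U : forall U : C, unit_ob ⊗ U = U;
  tensm_id1 : forall (U V : C) (f : mor U V),
    eqhom (tensU1 V) ∘ (f ⊠ idm unit_ob) = f ∘ eqhom (tensU1 U);
  id1_tensm : forall (U V : C) (f : mor U V),
    eqhom (tens1U V) ∘ (idm unit_ob ⊠ f) = f ∘ eqhom (tens1U U);
  PhiK : forall U V W : C, Phi_inv U V W ∘ Phi U V W = idm _;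
  PhiVK : forall U V W : C, Phi U V W ∘ Phi_inv U V W = idm _;
  Phi_nat : forall (U U' V V' W W' : C)
      (f : mor U U') (g : mor V V') (h : mor W W'),
    Phi U' V' W' ∘ (f ⊠ (g ⊠ h)) = ((f ⊠ g) ⊠ h) ∘ Phi U V W;
  pentagon : forall U V W X : C,
    Phi (U ⊗ V) W X ∘ Phi U V (W ⊗ X) =
    (Phi U V W ⊠ idm X) ∘ Phi U (V ⊗ W) X ∘ (idm U ⊠ Phi V W X);
  Phi_1l : forall (V W : C) (e : unit_ob ⊗ (V ⊗ W) = (unit_ob ⊗ V) ⊗ W),
    Phi unit_ob V W = eqhom e;
  Phi_1m : forall (U W : C) (e : U ⊗ (unit_ob ⊗ W) = (U ⊗ unit_ob) ⊗ W),
    Phi U unit_ob W = eqhom e;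
  Phi_1r : forall (U V : C) (e : U ⊗ (V ⊗ unit_ob) = (U ⊗ V) ⊗ unit_ob),
    Phi U V unit_ob = eqhom e;
  PsiK : forall U V : C, Psi_inv U V ∘ Psi U V = idm _;
  PsiVK : forall U V : C, Psi U V ∘ Psi_inv U V = idm _;
  Psi_nat : forall (U U' V V' : C) (f : mor U U') (g : mor V V'),
    Psi U' V' ∘ (f ⊠ g) = (g ⊠ f) ∘ Psi U V;
  hexagon1 : forall U V W : C,
    Phi W U V ∘ Psi (U ⊗ V) W ∘ Phi U V W =
    (Psi U W ⊠ idm V) ∘ Phi U W V ∘ (idm U ⊠ Psi V W);
  hexagon2 : forall U V W : C,
    Phi_inv V W U ∘ Psi U (V ⊗ W) ∘ Phi_inv U V W =
    (idm V ⊠ Psi U W) ∘ Phi_inv V U W ∘ (Psi U V ⊠ idm W);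
  Psi_1r : forall (U : C) (e : U ⊗ unit_ob = unit_ob ⊗ U),
    Psi U unit_ob = eqhom e;
  Psi_1l : forall (U : C) (e : unit_ob ⊗ U = U ⊗ unit_ob),
    Psi unit_ob U = eqhom e;
  epi_tens : forall (U U' V V' : C) (f : mor U U') (g : mor V V'),
    epi f -> epi g -> epi (f ⊠ g)
}.

Record braidedAbCat := BraidedAbCat {
  cat_data :> catData;
  cat_laws : braidedLaws cat_data
}.

(* ** Words, bracketings and the coherence isomorphisms *)

Definition letter (C : braidedAbCat) := {U : C | U <> unit_ob}.

(* A formal word U_1 ⊗ ... ⊗ U_n, all of whose letters differ from 1 if n > 1:
   the one-letter word 1 is encoded as the empty word, every other word as the
   list of its letters. The tensor product of words is then plain concatenation,
   with the (word) 1 as a strict unit. *)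
Definition word (C : braidedAbCat) := seq (letter C).

Section Words.
Variable C : braidedAbCat.
Implicit Types (U V : C) (u v w : word C).

(* tree w is the set of bracketings of the word w = U_1 ⊗ ... ⊗ U_n, n >= 1. *)
Inductive tree : word C -> Type :=
| Leaf (x : letter C) : tree [:: x]
| Node v w (a : tree v) (b : tree w) : tree (v ++ w).

Inductive bracketing : word C -> Type :=
| BUnit : bracketing [::]
| BTree w (a : tree w) : bracketing w.

Fixpoint tree_ob w (a : tree w) : C :=
  match a with
  | Leaf x => sval x
  | Node _ _ a b => tree_ob a ⊗ tree_ob b
  end.

(* The object (U_1 ⊗ ... ⊗ U_n; a) of C. *)
Definition bob w (a : bracketing w) : C :=
  match a with BUnit => unit_ob | BTree _ a => tree_ob a end.

(* The bracketing (a, b) of v ⊗ w; because 1 is a strict unit, it is b if v = 1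
   and a if w = 1. *)
Definition join v w (a : bracketing v) (b : bracketing w) :
    bracketing (v ++ w) :=
  match a in bracketing v', b in bracketing w' return bracketing (v' ++ w') with
  | BUnit, b => b
  | BTree v a, BUnit => eq_rect v bracketing (BTree a) _ (esym (cats0 v))
  | BTree _ a, BTree _ b => BTree (Node a b)
  end.

Lemma bob_join v w (a : bracketing v) (b : bracketing w) :
  bob (join a b) = bob a ⊗ bob b.
Proof.
case: a => [|{}v a]; first by rewrite /= (tens1U (cat_laws C)).
case: b => [|{}w b] //=; rewrite (tensU1 (cat_laws C)).
by case: _ / (esym (cats0 v)).
Qed.

Fixpoint right_bracketing w : bracketing w :=
  match w with
  | [::] => BUnit
  | x :: w' => join (BTree (Leaf x)) (right_bracketing w')
  end.

(* U_1 ⊗ (U_2 ⊗ (... ⊗ (U_n ⊗ 1))). *)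
Fixpoint normal_ob w : C :=
  match w with [::] => unit_ob | x :: w' => sval x ⊗ normal_ob w' end.

Fixpoint nmerge v w : mor (normal_ob v ⊗ normal_ob w) (normal_ob (v ++ w)) :=
  match v with
  | [::] => eqhom (tens1U (cat_laws C) (normal_ob w))
  | x :: v' => (idm (sval x) ⊠ nmerge v' w) ∘ Phi_inv _ _ _
  end.

Fixpoint nunmerge v w : mor (normal_ob (v ++ w)) (normal_ob v ⊗ normal_ob w) :=
  match v with
  | [::] => eqhom (esym (tens1U (cat_laws C) (normal_ob w)))
  | x :: v' => Phi _ _ _ ∘ (idm (sval x) ⊠ nunmerge v' w)
  end.

Fixpoint tree_normal w (a : tree w) : mor (tree_ob a) (normal_ob w) :=
  match a with
  | Leaf x => eqhom (esym (tensU1 (cat_laws C) (sval x)))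
  | Node v w a b => nmerge v w ∘ (tree_normal a ⊠ tree_normal b)
  end.

Fixpoint tree_unnormal w (a : tree w) : mor (normal_ob w) (tree_ob a) :=
  match a with
  | Leaf x => eqhom (tensU1 (cat_laws C) (sval x))
  | Node v w a b => (tree_unnormal a ⊠ tree_unnormal b) ∘ nunmerge v w
  end.

Definition normalize w (a : bracketing w) : mor (bob a) (normal_ob w) :=
  match a with BUnit => idm unit_ob | BTree _ a => tree_normal a end.

Definition unnormalize w (a : bracketing w) : mor (normal_ob w) (bob a) :=
  match a with BUnit => idm unit_ob | BTree _ a => tree_unnormal a end.

(* Mac Lane's isomorphism I^a_b, through the common normal form. That this is
   the family singled out by the coherence theorem is recorded below: coh_id,
   coh_comp, coh_join and coh_Phi. *)
Definition coh w (a b : bracketing w) : mor (bob a) (bob b) :=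
  unnormalize b ∘ normalize a.

Let laws := cat_laws C.

Lemma eqhom_id (U : C) (e : U = U) : eqhom e = idm U.
Proof. by rewrite (Prop_irrelevance e erefl). Qed.

Lemma eqhom_comp (U V W : C) (e : U = V) (e' : V = W) :
  eqhom e' ∘ eqhom e = eqhom (etrans e e').
Proof. by case: W / e'; case: V / e; rewrite /= (comp1m laws). Qed.

Lemma eqhomK (U V : C) (e : U = V) (e' : V = U) : eqhom e' ∘ eqhom e = idm U.
Proof. by rewrite eqhom_comp eqhom_id. Qed.

Lemma mergeK v w : nunmerge v w ∘ nmerge v w = idm _.
Proof.
elim: v => [|x v IH] /=; first exact: eqhomK.
rewrite (compA laws) -(compA laws (Phi _ _ _)) -(tens_comp laws).
by rewrite IH (comp1m laws) (tens11 laws) (compm1 laws) (PhiVK laws).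
Qed.

Lemma unmergeK v w : nmerge v w ∘ nunmerge v w = idm _.
Proof.
elim: v => [|x v IH] /=; first exact: eqhomK.
rewrite (compA laws) -(compA laws (idm _ ⊠ _)) (PhiK laws) (compm1 laws).
by rewrite -(tens_comp laws) IH (comp1m laws) (tens11 laws).
Qed.

Lemma normalizeK w (a : bracketing w) : unnormalize a ∘ normalize a = idm _.
Proof.
case: w / a => [|w a] /=; first exact: (comp1m laws).
elim: w / a => [x|v w a IHa b IHb] /=; first exact: eqhomK.
rewrite (compA laws) -(compA laws (_ ⊠ _)) mergeK (compm1 laws).
by rewrite -(tens_comp laws) IHa IHb (tens11 laws).
Qed.

Lemma unnormalizeK w (a : bracketing w) : normalize a ∘ unnormalize a = idm _.
Proof.
case: w / a => [|w a] /=; first exact: (comp1m laws).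
elim: w / a => [x|v w a IHa b IHb] /=; first exact: eqhomK.
rewrite (compA laws) -(compA laws (nmerge _ _)) -(tens_comp laws).
by rewrite IHa IHb (tens11 laws) (compm1 laws) unmergeK.
Qed.

Lemma coh_id w (a : bracketing w) : coh a a = idm (bob a).
Proof. exact: normalizeK. Qed.

Lemma coh_comp w (a b c : bracketing w) : coh b c ∘ coh a b = coh a c.
Proof.
rewrite /coh (compA laws) -(compA laws (unnormalize c)).
by rewrite unnormalizeK (compm1 laws).
Qed.

Definition conv (U U' V V' : C) (e : U = U') (e' : V = V') (f : mor U' V') :
    mor U V :=
  eqhom (esym e') ∘ f ∘ eqhom e.

Lemma convE (U V : C) (e : U = U) (e' : V = V) (f : mor U V) : conv e e' f = f.
Proof. by rewrite /conv !eqhom_id (comp1m laws) (compm1 laws). Qed.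

Lemma comp_conv (U U' V V' W W' : C) (e : U = U') (e' : V = V') (e1 : V = V')
    (e'' : W = W') (g : mor V' W') (f : mor U' V') :
  conv e1 e'' g ∘ conv e e' f = conv e e'' (g ∘ f).
Proof.
rewrite (Prop_irrelevance e1 e') {e1}; case: W' / e'' g => g.
case: V' / e' g f => g f; case: U' / e f => f.
by rewrite !convE.
Qed.

Lemma eqhom_tens (U U' V V' : C) (e : U = U') (e' : V = V') :
  eqhom e ⊠ eqhom e' = eqhom (f_equal2 tens e e').
Proof.
by case: U' / e; case: V' / e'; rewrite [RHS]eqhom_id; apply: (tens11 laws).
Qed.

Lemma Phi_inv_nat (U U' V V' W W' : C)
    (f : mor U U') (g : mor V V') (h : mor W W') :
  Phi_inv U' V' W' ∘ ((f ⊠ g) ⊠ h) = (f ⊠ (g ⊠ h)) ∘ Phi_inv U V W.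
Proof.
rewrite -[LHS](compm1 laws) -(PhiVK laws) (compA laws).
rewrite -(compA laws (Phi_inv _ _ _)).
by rewrite -(Phi_nat laws) (compA laws (Phi_inv _ _ _)) (PhiK laws) (comp1m laws).
Qed.

Lemma pentagon_inv (U V W X : C) :
  Phi_inv U (V ⊗ W) X ∘ ((Phi_inv U V W ⊠ idm X) ∘ Phi (U ⊗ V) W X) =
  (idm U ⊠ Phi V W X) ∘ Phi_inv U V (W ⊗ X).
Proof.
rewrite -[LHS](compm1 laws) -(PhiVK laws U V (W ⊗ X)) -!(compA laws).
rewrite (compA laws (Phi _ _ _) (Phi _ _ _)) (pentagon laws) !(compA laws).
rewrite -(compA laws (Phi_inv _ _ _) (_ ⊠ _)) -(tens_comp laws).
by rewrite (PhiK laws) (comp1m laws) (tens11 laws) (compm1 laws) (PhiK laws)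
  (comp1m laws).
Qed.

Lemma merge0 w (e : normal_ob w ⊗ unit_ob = normal_ob (w ++ [::])) :
  nmerge w [::] = eqhom e.
Proof.
elim: w e => [|x w IH] e /=; first by congr eqhom; apply: Prop_irrelevance.
have e0 : normal_ob w ⊗ unit_ob = normal_ob (w ++ [::]).
  by rewrite cats0 (tensU1 laws).
have eP : sval x ⊗ (normal_ob w ⊗ unit_ob) = (sval x ⊗ normal_ob w) ⊗ unit_ob.
  by rewrite !(tensU1 laws).
have -> : Phi_inv (sval x) (normal_ob w) unit_ob = eqhom (esym eP).
  rewrite -[LHS](compm1 laws) -(eqhomK (esym eP) eP) (compA laws).
  by rewrite -(Phi_1r laws) (PhiK laws) (comp1m laws).
rewrite (IH e0) -[idm _]/(eqhom erefl) eqhom_tens eqhom_comp.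
by congr eqhom; apply: Prop_irrelevance.
Qed.

Lemma normalize_cast v w (e : v = w) (a : bracketing v)
    (eo : bob (eq_rect v bracketing a w e) = bob a) :
  normalize (eq_rect v bracketing a w e) =
  conv eo (f_equal normal_ob (esym e)) (normalize a).
Proof. by case: _ / e eo => eo; rewrite convE. Qed.

Lemma unnormalize_cast v w (e : v = w) (a : bracketing v)
    (eo : bob (eq_rect v bracketing a w e) = bob a) :
  unnormalize (eq_rect v bracketing a w e) =
  conv (f_equal normal_ob (esym e)) eo (unnormalize a).
Proof. by case: _ / e eo => eo; rewrite convE. Qed.

Lemma normalize_join v w (a : bracketing v) (b : bracketing w) :
  normalize (join a b) =
  nmerge v w ∘ (normalize a ⊠ normalize b) ∘ eqhom (bob_join a b).
Proof.
case: v / a (bob_join a b) => [|v a] e /=.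
  by rewrite (id1_tensm laws) -(compA laws) eqhomK (compm1 laws).
case: w / b e => [|w b] /= e; last by rewrite eqhom_id (compm1 laws).
have eo := etrans e (tensU1 laws _); rewrite (normalize_cast eo) /conv /=.
rewrite (merge0 (etrans (tensU1 laws _) (f_equal normal_ob (esym (cats0 v))))).
rewrite -eqhom_comp.
rewrite -(compA laws (eqhom (f_equal _ _))) (tensm_id1 laws).
rewrite (compA laws) -(compA laws _ _ (eqhom e)) eqhom_comp.
by congr (eqhom _ ∘ _ ∘ eqhom _); apply: Prop_irrelevance.
Qed.

Lemma unnormalize_join v w (a : bracketing v) (b : bracketing w) :
  unnormalize (join a b) =
  eqhom (esym (bob_join a b)) ∘ (unnormalize a ⊠ unnormalize b) ∘ nunmerge v w.
Proof.
rewrite -[RHS](comp1m laws) -(normalizeK (join a b)) -(compA laws).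
rewrite normalize_join !(compA laws).
rewrite -(compA laws _ (eqhom _) (eqhom _)) eqhomK (compm1 laws).
rewrite -(compA laws _ (_ ⊠ _) (_ ⊠ _)) -(tens_comp laws) !unnormalizeK.
rewrite (tens11 laws) (compm1 laws) -(compA laws _ (nmerge _ _)) unmergeK.
by rewrite (compm1 laws).
Qed.

Lemma coh_join v w (a a' : bracketing v) (b b' : bracketing w) :
  coh (join a b) (join a' b') =
  conv (bob_join a b) (bob_join a' b') (coh a a' ⊠ coh b b').
Proof.
rewrite /coh normalize_join unnormalize_join /conv !(compA laws).
rewrite -(compA laws _ (nunmerge _ _)) mergeK (compm1 laws).
by rewrite -(compA laws (eqhom _)) -(tens_comp laws).
Qed.

Lemma merge_assoc u v w
    (e : normal_ob (u ++ (v ++ w)) = normal_ob ((u ++ v) ++ w)) :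
  nmerge (u ++ v) w ∘ (nmerge u v ⊠ idm _) ∘ Phi _ _ _ =
  eqhom e ∘ nmerge u (v ++ w) ∘ (idm _ ⊠ nmerge v w).
Proof.
elim: u e => [|x u IH] e /=.
  have e1 : unit_ob ⊗ (normal_ob v ⊗ normal_ob w) =
    (unit_ob ⊗ normal_ob v) ⊗ normal_ob w by rewrite !(tens1U laws).
  rewrite (Phi_1l laws e1) -(compA laws (eqhom e)) (id1_tensm laws).
  rewrite -[idm (normal_ob w)]/(eqhom erefl) eqhom_tens -(compA laws).
  rewrite eqhom_comp eqhom_id (comp1m laws).
  by congr (_ ∘ eqhom _); apply: Prop_irrelevance.
have e0 : normal_ob (u ++ (v ++ w)) = normal_ob ((u ++ v) ++ w).
  by rewrite catA.
have -> : eqhom e = idm (sval x) ⊠ eqhom e0.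
  rewrite -[idm _]/(eqhom erefl) eqhom_tens.
  by congr eqhom; apply: Prop_irrelevance.
rewrite -(tens11 laws) -!(compA laws) (compA laws (Phi_inv _ _ _) (_ ⊠ _)).
rewrite -{1}[idm (normal_ob w)](comp1m laws) (tens_comp laws).
rewrite !(compA laws) -(compA laws _ (Phi_inv _ _ _) (_ ⊠ _)).
rewrite !Phi_inv_nat -!(compA laws) pentagon_inv !(compA laws).
rewrite -[in RHS](compA laws _ (Phi_inv _ _ _) (_ ⊠ _)) Phi_inv_nat.
by rewrite (compA laws) -!(tens_comp laws) !(comp1m laws) IH.
Qed.

Lemma coh_Phi u v w (a : tree u) (b : tree v) (c : tree w)
    (e : (u ++ v) ++ w = u ++ (v ++ w))
    (eo : bob (eq_rect _ bracketing (BTree (Node (Node a b) c)) _ e) =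
          (tree_ob a ⊗ tree_ob b) ⊗ tree_ob c) :
  coh (BTree (Node a (Node b c)))
      (eq_rect _ bracketing (BTree (Node (Node a b) c)) _ e) =
  eqhom (esym eo) ∘ Phi (tree_ob a) (tree_ob b) (tree_ob c).
Proof.
have e' : normal_ob (u ++ (v ++ w)) = normal_ob ((u ++ v) ++ w) by rewrite catA.
have key : eqhom e' ∘ normalize (BTree (Node a (Node b c))) =
    normalize (BTree (Node (Node a b) c)) ∘
    Phi (tree_ob a) (tree_ob b) (tree_ob c).
  rewrite /= -{1}[tree_normal a](comp1m laws) -{2}[tree_normal c](comp1m laws).
  rewrite !(tens_comp laws) -!(compA laws) -(Phi_nat laws) !(compA laws).
  by rewrite merge_assoc.
rewrite /coh (unnormalize_cast eo) /conv (Prop_irrelevance (f_equal _ _) e').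
rewrite -(compA laws _ (eqhom e')) key -(compA laws _ (unnormalize _)).
by rewrite (compA laws (unnormalize _)) normalizeK (comp1m laws).
Qed.

End Words.

(* ** The strict extension of C *)

Section StrictExtension.
Variable C : braidedAbCat.
Implicit Types u v w : word C.

(* A morphism v -> w of the strict extension is a class of morphisms
   (v; a) -> (w; b) of C modulo f ~ I^b_b' f I^a'_a. A class has exactly one
   representative for each pair (a, b), and is given here by the family of its
   representatives; cls a b f is the class of f. *)
Record bhom v w := BHom {
  rep : forall (a : bracketing v) (b : bracketing w), mor (bob a) (bob b);
  repP : forall a b a' b', rep a' b' = coh b b' ∘ rep a b ∘ coh a' a
}.

Let laws := cat_laws C.

Lemma bhomP v w (f g : bhom v w) a b : rep f a b = rep g a b -> f = g.
Proof.
case: f g => [f fP] [g gP] /= fg.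
have {}fg : f = g.
  by do 2!apply: functional_extensionality_dep => ?; rewrite (fP a b) fg -gP.
by case: g / fg gP => gP; congr BHom; apply: Prop_irrelevance.
Qed.

Lemma cls_subproof v w (a0 : bracketing v) (b0 : bracketing w)
    (f : mor (bob a0) (bob b0)) a b a' b' :
  coh b0 b' ∘ f ∘ coh a' a0 =
  coh b b' ∘ (coh b0 b ∘ f ∘ coh a a0) ∘ coh a' a.
Proof.
rewrite -(coh_comp b0 b b') -(coh_comp a' a a0).
move: (coh b b') (coh b0 b) (coh a a0) (coh a' a) => x y z t.
by rewrite !(compA laws).
Qed.

Definition cls v w (a : bracketing v) (b : bracketing w)
    (f : mor (bob a) (bob b)) : bhom v w :=
  BHom (cls_subproof f).

Lemma rep_cls v w (a : bracketing v) (b : bracketing w)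
    (f : mor (bob a) (bob b)) : rep (cls f) a b = f.
Proof. by rewrite /= !coh_id (comp1m laws) (compm1 laws). Qed.

Lemma clsE v w (f : bhom v w) a b : f = cls (rep f a b).
Proof. by apply: (@bhomP _ _ _ _ a b); rewrite rep_cls. Qed.

Lemma cls_eq v w (a a' : bracketing v) (b b' : bracketing w)
    (f : mor (bob a) (bob b)) (g : mor (bob a') (bob b')) :
  cls f = cls g <-> g = coh b b' ∘ f ∘ coh a' a.
Proof.
split=> [fg|->]; last by apply: (@bhomP _ _ _ _ a' b'); rewrite rep_cls.
by rewrite -[LHS]rep_cls -fg.
Qed.

HB.instance Definition _ v w := gen_eqMixin (bhom v w).
HB.instance Definition _ v w := gen_choiceMixin (bhom v w).

Lemma comp0m (U V W : C) (f : mor U V) : (0 : mor V W) ∘ f = 0.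
Proof. by apply: (addrI ((0 : mor V W) ∘ f)); rewrite -(compDl laws) !addr0. Qed.

Lemma compm0 (U V W : C) (g : mor V W) : g ∘ (0 : mor U V) = 0.
Proof. by apply: (addrI (g ∘ (0 : mor U V))); rewrite -(compDr laws) !addr0. Qed.

Lemma compNm (U V W : C) (g : mor V W) (f : mor U V) : (- g) ∘ f = - (g ∘ f).
Proof. by apply: (addrI (g ∘ f)); rewrite -(compDl laws) !subrr comp0m. Qed.

Lemma compmN (U V W : C) (g : mor V W) (f : mor U V) : g ∘ (- f) = - (g ∘ f).
Proof. by apply: (addrI (g ∘ f)); rewrite -(compDr laws) !subrr compm0. Qed.

Fact bzero_subproof v w a b a' b' :
  0 = coh b b' ∘ (0 : mor (bob a) (bob b)) ∘ coh a' a
    :> mor (@bob C v a') (@bob C w b').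
Proof. by rewrite compm0 comp0m. Qed.

Definition bzero v w : bhom v w := BHom (@bzero_subproof v w).

Fact badd_subproof v w (f g : bhom v w) a b a' b' :
  rep f a' b' + rep g a' b' =
  coh b b' ∘ (rep f a b + rep g a b) ∘ coh a' a.
Proof. by rewrite (repP f a b) (repP g a b) (compDr laws) (compDl laws). Qed.

Definition badd v w (f g : bhom v w) : bhom v w := BHom (badd_subproof f g).

Fact bopp_subproof v w (f : bhom v w) a b a' b' :
  - rep f a' b' = coh b b' ∘ (- rep f a b) ∘ coh a' a.
Proof. by rewrite (repP f a b) compmN compNm. Qed.

Definition bopp v w (f : bhom v w) : bhom v w := BHom (bopp_subproof f).

Let rb := @right_bracketing C.

Fact baddA v w : associative (@badd v w).
Proof. by move=> f g h; apply: (@bhomP _ _ _ _ (rb v) (rb w)); apply: addrA. Qed.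

Fact baddC v w : commutative (@badd v w).
Proof. by move=> f g; apply: (@bhomP _ _ _ _ (rb v) (rb w)); apply: addrC. Qed.

Fact badd0 v w : left_id (bzero v w) (@badd v w).
Proof. by move=> f; apply: (@bhomP _ _ _ _ (rb v) (rb w)); apply: add0r. Qed.

Fact baddN v w : left_inverse (bzero v w) (@bopp v w) (@badd v w).
Proof. by move=> f; apply: (@bhomP _ _ _ _ (rb v) (rb w)); apply: addNr. Qed.

HB.instance Definition _ v w :=
  GRing.isZmodule.Build (bhom v w) (@baddA v w) (@baddC v w) (@badd0 v w)
    (@baddN v w).

Definition bid w : bhom w w := cls (idm (bob (rb w))).

(* The equality v = w, regarded as the identity morphism. *)
Definition beqhom v w (e : v = w) : bhom v w :=
  match e in _ = w' return bhom v w' with erefl => bid v end.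

(* In bcomp, btens and bbraid the bracketings are fixed to right_bracketing;
   rep_bcomp, rep_btens and rep_bbraid show that any others give the same
   classes. *)
Definition bcomp u v w (g : bhom v w) (f : bhom u v) : bhom u w :=
  cls (rep g (rb v) (rb w) ∘ rep f (rb u) (rb v)).

Definition btens v w v' w' (f : bhom v v') (g : bhom w w') :
    bhom (v ++ w) (v' ++ w') :=
  cls (conv (bob_join (rb v) (rb w)) (bob_join (rb v') (rb w'))
    (rep f (rb v) (rb v') ⊠ rep g (rb w) (rb w'))).

Definition bbraid v w : bhom (v ++ w) (w ++ v) :=
  cls (conv (bob_join (rb v) (rb w)) (bob_join (rb w) (rb v))
    (Psi (bob (rb v)) (bob (rb w)))).

Lemma rep_bid w (a : bracketing w) : rep (bid w) a a = idm (bob a).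
Proof. by rewrite /= (compm1 laws) coh_comp coh_id. Qed.

Lemma rep_bcomp u v w (g : bhom v w) (f : bhom u v) a b c :
  rep (bcomp g f) a c = rep g b c ∘ rep f a b.
Proof.
rewrite (repP g (rb v) (rb w) b c) (repP f (rb u) (rb v) a b).
rewrite [LHS]/= -[rep f _ _ in LHS](comp1m laws) -(coh_id (rb v)).
rewrite -(coh_comp (rb v) b (rb v)).
move: (coh (rb v) b) (coh b (rb v)) (coh (rb w) c) (coh a (rb u)) => x y z t.
by rewrite !(compA laws).
Qed.

Lemma rep_btens v w v' w' (f : bhom v v') (g : bhom w w') a b a' b' :
  rep (btens f g) (join a b) (join a' b') =
  conv (bob_join a b) (bob_join a' b') (rep f a a' ⊠ rep g b b').
Proof.
rewrite (repP f (rb v) (rb v') a a') (repP g (rb w) (rb w') b b').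
rewrite [LHS]/= !coh_join !comp_conv.
move: (coh a (rb v)) (coh b (rb w)) (coh (rb v') a') (coh (rb w') b').
by move=> x y z t; rewrite !(tens_comp laws).
Qed.

Lemma rep_bbraid v w a b :
  rep (bbraid v w) (join a b) (join b a) =
  conv (bob_join a b) (bob_join b a) (Psi (bob a) (bob b)).
Proof.
rewrite [LHS]/= !coh_join !comp_conv -(Psi_nat laws) -(compA laws).
by rewrite -(tens_comp laws) !coh_comp !coh_id (tens11 laws) (compm1 laws).
Qed.

(* The object U of C as a word of the strict extension. *)
Definition word1 (U : C) : word C :=
  match pselect (U = unit_ob) with
  | left _ => [::]
  | right U1 => [:: exist _ U U1]
  end.

Definition bracketing1 (U : C) : bracketing (word1 U) :=
  match pselect (U = unit_ob) as p return bracketing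
    match p with left _ => [::] | right U1 => [:: exist _ U U1] end
  with
  | left _ => BUnit C
  | right U1 => BTree (Leaf (exist _ U U1))
  end.

Lemma bob_bracketing1 (U : C) : bob (bracketing1 U) = U.
Proof. by rewrite /bracketing1 /word1; case: pselect. Qed.

Lemma bob_bracketing2 (U V : C) :
  bob (join (bracketing1 U) (bracketing1 V)) = U ⊗ V.
Proof. by rewrite bob_join !bob_bracketing1. Qed.

(* Morphisms U -> V, U ⊗ V -> W and U -> 1 of C, as morphisms of the strict
   extension. *)
Definition bar (U V : C) (f : mor U V) : bhom (word1 U) (word1 V) :=
  cls (conv (bob_bracketing1 U) (bob_bracketing1 V) f).

Definition bar2 (U V W : C) (f : mor (U ⊗ V) W) :
    bhom (word1 U ++ word1 V) (word1 W) :=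
  cls (conv (bob_bracketing2 U V) (bob_bracketing1 W) f).

Definition bar_to1 (U : C) (f : mor U unit_ob) : bhom (word1 U) [::] :=
  cls (b := BUnit C) (conv (bob_bracketing1 U) erefl f).

(* U ⊗ ... ⊗ U, k factors. *)
Fixpoint wpow (U : C) (k : nat) : word C :=
  if k is k'.+1 then word1 U ++ wpow U k' else [::].

Lemma wpowSr (U : C) k : wpow U k.+1 = wpow U k ++ word1 U.
Proof. by elim: k => [|k IH] /=; rewrite ?cats0 // -catA -IH. Qed.

Lemma wpowD (U : C) i j : wpow U i ++ wpow U j = wpow U (i + j).
Proof. by elim: i => //= i IH; rewrite -catA IH. Qed.

End StrictExtension.

Notation "g ∘ f" := (bcomp g f) : bar_scope.
Notation "f ⊠ g" := (btens f g) : bar_scope.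

(* ** Ribbon algebras and differential calculi

   These live in C itself; an equation of the strict extension is written out
   between representatives, Phi and the equalities U ⊗ 1 = U = 1 ⊗ U becoming
   explicit. *)

Record algebra (C : braidedAbCat) := Algebra {
  alg_ob :> C;
  alg_m : mor (alg_ob ⊗ alg_ob) alg_ob;
  alg_eta : mor unit_ob alg_ob;
  alg_assoc : alg_m ∘ (idm alg_ob ⊠ alg_m) =
    alg_m ∘ (alg_m ⊠ idm alg_ob) ∘ Phi alg_ob alg_ob alg_ob;
  alg_unitr : alg_m ∘ (idm alg_ob ⊠ alg_eta) =
    eqhom (tensU1 (cat_laws C) alg_ob);
  alg_unitl : alg_m ∘ (alg_eta ⊠ idm alg_ob) =
    eqhom (tens1U (cat_laws C) alg_ob)
}.

Record ribbonAlgebra (C : braidedAbCat) := RibbonAlgebra {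
  rib_alg :> algebra C;
  sigma : mor rib_alg rib_alg;
  sigma_iso : exists tau : mor rib_alg rib_alg,
    tau ∘ sigma = idm rib_alg /\ sigma ∘ tau = idm rib_alg;
  sigma_m : alg_m rib_alg ∘ (sigma ⊠ sigma) ∘ Psi rib_alg rib_alg
    ∘ Psi rib_alg rib_alg = sigma ∘ alg_m rib_alg;
  sigma_eta : sigma ∘ alg_eta rib_alg = alg_eta rib_alg
}.

(* The graded object A, X 0, X 1, ... *)
Definition graded (C : braidedAbCat) (A : C) (X : nat -> C) (i : nat) : C :=
  if i is i'.+1 then X i' else A.

(* The objects are A = Ω_0 and Ω_i = dc_pos (i - 1) for i > 0. The target
   degree of dc_mul and dc_d is a variable constrained by an equation, so that
   no transport is needed in the axioms. No axiom mentions anything of degree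
   > n: that part of the data is meaningless and stands for 0, and the identities
   with values in degree > n hold trivially. *)
Record diffCalculus (C : braidedAbCat) (A : algebra C) (n : nat) :=
  DiffCalculus {
  dc_pos : nat -> C;
  dc_ob := graded A dc_pos;
  dc_mul : forall i j k, (i + j)%N = k ->
    mor (dc_ob i ⊗ dc_ob j) (dc_ob k);
  dc_d : forall i k, i.+1 = k -> mor (dc_ob i) (dc_ob k);
  dc_mul00 : forall e, dc_mul (i := 0) (j := 0) (k := 0) e = alg_m A;
  dc_assoc : forall i j k ij jk l (e1 : (i + j)%N = ij) (e2 : (ij + k)%N = l)
      (e3 : (j + k)%N = jk) (e4 : (i + jk)%N = l), (l <= n)%N ->
    dc_mul e4 ∘ (idm (dc_ob i) ⊠ dc_mul e3) =
    dc_mul e2 ∘ (dc_mul e1 ⊠ idm (dc_ob k)) ∘ Phi _ _ _;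
  dc_unitl : forall i (e : (0 + i)%N = i), (i <= n)%N ->
    dc_mul e ∘ (alg_eta A ⊠ idm (dc_ob i)) =
    eqhom (tens1U (cat_laws C) (dc_ob i));
  dc_unitr : forall i (e : (i + 0)%N = i), (i <= n)%N ->
    dc_mul e ∘ (idm (dc_ob i) ⊠ alg_eta A) =
    eqhom (tensU1 (cat_laws C) (dc_ob i));
  dc_dd : forall i j k (e1 : i.+1 = j) (e2 : j.+1 = k), (k <= n)%N ->
    dc_d e2 ∘ dc_d e1 = 0;
  dc_leibniz : forall i j k i' j' k' (e : (i + j)%N = k)
      (ei : i.+1 = i') (ej : j.+1 = j') (ek : k.+1 = k')
      (el : (i' + j)%N = k') (er : (i + j')%N = k'), (k' <= n)%N ->
    dc_d ek ∘ dc_mul e =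
    dc_mul el ∘ (dc_d ei ⊠ idm (dc_ob j)) +
    (dc_mul er ∘ (idm (dc_ob i) ⊠ dc_d ej)) *~ (-1) ^+ i;
  dc_epi : forall k k' (ek : k.+1 = k') (e : (0 + k')%N = k'), (k' <= n)%N ->
    epi (dc_mul e ∘ (idm (dc_ob 0) ⊠ dc_d ek))
}.

Section Cocycle.
Variables (C : braidedAbCat) (A : ribbonAlgebra C).
Local Open Scope bar_scope.

Local Notation "A ^⊗ k" := (wpow A k) (at level 30).
Local Notation id_ k := (bid (A ^⊗ k)).

Definition weak_ribbon_graded_trace n (Om : diffCalculus A n)
    (int : mor (dc_ob Om n) unit_ob) : Prop :=
  (int ∘ dc_mul Om (addn0 n) =
   int ∘ dc_mul Om (add0n n) ∘ (sigma A ⊠ idm (dc_ob Om n))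
     ∘ Psi (dc_ob Om n) (dc_ob Om 0))%C.

Definition closed_trace n (Om : diffCalculus A n)
    (int : mor (dc_ob Om n) unit_ob) : Prop :=
  forall i (e : i.+1 = n), (int ∘ dc_d Om e)%C = 0.

(* (σ ⊗ id_n) Ψ_{A^n, A} : A^(n+1) -> A^(n+1) *)
Definition rotation n : bhom (A ^⊗ n.+1) (A ^⊗ n.+1) :=
  (bar (sigma A) ⊠ id_ n) ∘ bbraid (A ^⊗ n) (word1 A) ∘ beqhom (wpowSr A n).

Definition lambda n : bhom (A ^⊗ n.+1) (A ^⊗ n.+1) :=
  rotation n *~ (-1) ^+ n.

(* m ⊗ id_k : A^(k+2) -> A^(k+1) *)
Definition mul_first k : bhom (A ^⊗ k.+2) (A ^⊗ k.+1) :=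
  (bar2 (alg_m A) ⊠ id_ k) ∘
  beqhom (catA (word1 A) (word1 A) (A ^⊗ k)).

Fact wpow_split n i c : (i < n.+1)%N ->
  A ^⊗ (c + n) = A ^⊗ i ++ A ^⊗ (c + (n - i)).
Proof. by move=> le_in; rewrite wpowD addnCA subnKC. Qed.

(* inner_face n i is d_i^(n+1) = id_i ⊗ m ⊗ id_(n-i) for i <= n, last_face n is
   d_(n+1)^(n+1), and face n i is d_i^(n+1) : A^(n+2) -> A^(n+1). *)
Definition inner_face n (i : 'I_n.+1) : bhom (A ^⊗ n.+2) (A ^⊗ n.+1) :=
  beqhom (esym (wpow_split 1 (ltn_ord i))) ∘
  (id_ i ⊠ mul_first (n - i)) ∘
  beqhom (wpow_split 2 (ltn_ord i)).

Definition last_face n : bhom (A ^⊗ n.+2) (A ^⊗ n.+1) :=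
  mul_first n ∘ rotation n.+1.

Definition face n (i : 'I_n.+2) : bhom (A ^⊗ n.+2) (A ^⊗ n.+1) :=
  if unlift ord_max i is Some j then inner_face j else last_face n.

Definition hochschild n (phi : bhom (A ^⊗ n.+1) [::]) : bhom (A ^⊗ n.+2) [::] :=
  \sum_(i < n.+2) (phi ∘ face i) *~ (-1) ^+ i.

Definition C_lambda n (phi : bhom (A ^⊗ n.+1) [::]) : Prop :=
  phi ∘ lambda n = phi.

Definition Z_lambda n (phi : bhom (A ^⊗ n.+1) [::]) : Prop :=
  C_lambda phi /\ hochschild phi = 0.

Section Character.
Variables (n : nat) (Om : diffCalculus A n).

Local Notation Om1 := (dc_ob Om 1).

Fact wpow_snoc k :
  word1 A ++ wpow Om1 k.+1 = (word1 A ++ wpow Om1 k) ++ word1 Om1.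
Proof. by rewrite wpowSr catA. Qed.

(* m : A ⊗ Ω_1 ⊗ ... ⊗ Ω_1 -> Ω_k, multiplying from the left. *)
Fixpoint dc_prod k : bhom (word1 A ++ wpow Om1 k) (word1 (dc_ob Om k)) :=
  match k with
  | 0 => beqhom (cats0 (word1 A))
  | k'.+1 => bar2 (dc_mul Om (addn1 k')) ∘ (dc_prod k' ⊠ bid (word1 Om1))
      ∘ beqhom (wpow_snoc k')
  end.

(* d ⊗ ... ⊗ d, k factors *)
Fixpoint dc_dpow k : bhom (wpow A k) (wpow Om1 k) :=
  match k with
  | 0 => bid [::]
  | k'.+1 => bar (dc_d Om (erefl 1%N)) ⊠ dc_dpow k'
  end.

(* ∫ m (id ⊗ d ⊗ ... ⊗ d) *)
Definition dc_character (int : mor (dc_ob Om n) unit_ob) :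
    bhom (A ^⊗ n.+1) [::] :=
  bar_to1 int ∘ dc_prod n ∘ (bid (word1 A) ⊠ dc_dpow n).

End Character.

End Cocycle.

(* Main.v *)
From HB Require Import structures.
From mathcomp Require Import all_boot all_order all_algebra.
From mathcomp Require Import boolp.
Require Import Defs.

(** Think of morphisms v -> Ω_k of the strict extension as Ω_k-valued elements
    in the variables listed by the word v. The multiplications of Ω turn a
    v-element of Ω_i and a w-element of Ω_j into a (v ++ w)-element of
    Ω_(i + j), and for this product [gmul] the axioms of a calculus are the
    identities of an ordinary differential graded algebra ([dc_gmulA],
    [leibniz], [bar_dd]). Hence the computations of the classical case can be
    repeated, as long as no variable is permuted. Only the last variable ever
    gets permuted, in the rotation and in the last face, and [trace_rotation]
    handles it: by naturality of the braiding, the trace property says that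
      ∫ a ω, precomposed with (σ ⊗ id) Ψ, equals ∫ ω a
    for every element ω of Ω_n, a being the generic element of A.

    Let ω_k = a_0 da_1 ... da_k ([form]), so that φ = ∫ ω_n. Besides its
    definition ω_(k+1) = ω_k da_(k+1), it satisfies ω_(k+1) = a_0 dω_k, with the
    variables of ω_k shifted ([form_cons]), because dω_k = da_0 ... da_k.

    Cyclicity. For n = k + 1, the rotation of φ = ∫ a_0 dω_k is ∫ dω_k a, that
    is, - (-1)^k ∫ ω_k da = (-1)^n φ, because ∫ d(ω_k a) = 0. For n = 0 apply
    the trace property to ω = η.

    Hochschild coboundary. The alternating sum of the inner faces telescopes to
    (-1)^n ∫ ω_n a ([inner_faces_sum]). The last face gives the rotation of
    ∫ a ω_n, which is again ∫ ω_n a, with the opposite sign.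

    The identities of the strict extension are proved on normal forms: a
    morphism v -> w of the strict extension is the same thing as a morphism
    between the right-bracketed objects [normal_ob v] and [normal_ob w] of C,
    and [nf] turns tensor products and braidings of words into those of C,
    conjugated by the merging isomorphisms. *)

Set Implicit Arguments.
Unset Strict Implicit.
Unset Printing Implicit Defensive.

Import GRing.Theory.
Local Open Scope ring_scope.

(** * Normal forms of the morphisms of the strict extension *)

Section NormalForms.
Variable C : braidedAbCat.
Implicit Types (U V W : C) (u v w : word C).
Let laws := cat_laws C.
Local Open Scope cat_scope.
Local Notation rb := (@right_bracketing C _).

Lemma eqhomKl U V X (e : U = V) (e' : V = U) (f : mor X U) :
  eqhom e' ∘ (eqhom e ∘ f) = f.
Proof. by rewrite (compA laws) eqhomK (comp1m laws). Qed.

Lemma normalizeKl w (a : bracketing w) X (f : mor X (bob a)) :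
  unnormalize a ∘ (normalize a ∘ f) = f.
Proof. by rewrite (compA laws) normalizeK (comp1m laws). Qed.

Lemma unnormalizeKl w (a : bracketing w) X (f : mor X (normal_ob w)) :
  normalize a ∘ (unnormalize a ∘ f) = f.
Proof. by rewrite (compA laws) unnormalizeK (comp1m laws). Qed.

Lemma nmergeKl v w X (f : mor X (normal_ob v ⊗ normal_ob w)) :
  nunmerge v w ∘ (nmerge v w ∘ f) = f.
Proof. by rewrite (compA laws) mergeK (comp1m laws). Qed.

Lemma tens_compl U U' U'' V V' V'' X (f' : mor U' U'') (f : mor U U')
    (g' : mor V' V'') (g : mor V V') (h : mor X (U ⊗ V)) :
  (f' ⊠ g') ∘ ((f ⊠ g) ∘ h) = ((f' ∘ f) ⊠ (g' ∘ g)) ∘ h.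
Proof. by rewrite (compA laws) -(tens_comp laws). Qed.

(** Transporting a class to the normal objects removes the choice of
    bracketings, by [nfE]. The result is locked, here and in the definitions
    below, so that associativity does not rearrange the inside of it. *)
Definition nf v w (f : bhom v w) : mor (normal_ob v) (normal_ob w) :=
  locked (normalize rb ∘ (rep f rb rb ∘ unnormalize rb)).

Lemma nfE v w (f : bhom v w) a b :
  nf f = normalize b ∘ (rep f a b ∘ unnormalize a).
Proof.
rewrite /nf -!lock (repP f a b) /coh -!(compA laws) unnormalizeKl.
by rewrite unnormalizeK (compm1 laws).
Qed.

Lemma nf_cls v w (a : bracketing v) (b : bracketing w)
    (f : mor (bob a) (bob b)) :
  nf (cls f) = normalize b ∘ (f ∘ unnormalize a).
Proof. by rewrite (nfE _ a b) rep_cls. Qed.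

Lemma nf_inj v w : injective (@nf v w).
Proof.
move=> f g fg; apply: (@bhomP _ _ _ _ _ rb rb).
have repE (h : bhom v w) : rep h rb rb = unnormalize rb ∘ (nf h ∘ normalize rb).
  by rewrite /nf -!lock -!(compA laws) normalizeKl normalizeK (compm1 laws).
by rewrite !repE fg.
Qed.

Lemma nf_comp u v w (g : bhom v w) (f : bhom u v) :
  nf (bcomp g f) = nf g ∘ nf f.
Proof. by rewrite /bcomp nf_cls /nf -!lock -!(compA laws) normalizeKl. Qed.

Lemma nf_id w : nf (bid w) = idm (normal_ob w).
Proof. by rewrite /bid nf_cls (comp1m laws) unnormalizeK. Qed.

Lemma nf_beqhom v w (e : v = w) :
  nf (beqhom e) = eqhom (f_equal (@normal_ob C) e).
Proof. by case: w / e; apply: nf_id. Qed.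

Lemma nf_add v w (f g : bhom v w) : nf (f + g) = nf f + nf g.
Proof. by rewrite /nf -!lock -(compDr laws) -(compDl laws). Qed.

Lemma nf0 v w : nf (0 : bhom v w) = 0.
Proof. by apply: (addrI (nf (0 : bhom v w))); rewrite -nf_add !addr0. Qed.

Lemma nf_tens v w v' w' (f : bhom v v') (g : bhom w w') :
  nf (btens f g) = nmerge _ _ ∘ ((nf f ⊠ nf g) ∘ nunmerge _ _).
Proof.
rewrite /btens nf_cls normalize_join unnormalize_join /conv -!(compA laws).
by rewrite !eqhomKl !tens_compl /nf -!lock !(compA laws).
Qed.

Lemma nf_braid v w :
  nf (bbraid v w) = nmerge w v ∘ (Psi _ _ ∘ nunmerge v w).
Proof.
rewrite /bbraid nf_cls normalize_join unnormalize_join /conv -!(compA laws).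
rewrite !eqhomKl (compA laws (Psi _ _)) (Psi_nat laws) -!(compA laws).
by rewrite tens_compl !unnormalizeK (tens11 laws) (comp1m laws).
Qed.

(** The normal object of [word1 U] is U ⊗ 1, or 1 if U = 1. It equals U in both
    cases, but not definitionally: hence this pair of inverse arrows, which
    hides the case distinction. *)
Definition enter U : mor U (normal_ob (word1 U)) :=
  locked (normalize (bracketing1 U) ∘ eqhom (esym (bob_bracketing1 U))).

Definition leave U : mor (normal_ob (word1 U)) U :=
  locked (eqhom (bob_bracketing1 U) ∘ unnormalize (bracketing1 U)).

Lemma enterK U : leave U ∘ enter U = idm U.
Proof. by rewrite /leave /enter -!lock -(compA laws) normalizeKl eqhomK. Qed.

Lemma leaveK U : enter U ∘ leave U = idm _.
Proof. by rewrite /leave /enter -!lock -(compA laws) eqhomKl unnormalizeK. Qed.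

Lemma enterKl U X (f : mor X U) : leave U ∘ (enter U ∘ f) = f.
Proof. by rewrite (compA laws) enterK (comp1m laws). Qed.

Lemma nf_bar U V (f : mor U V) : nf (bar f) = enter V ∘ (f ∘ leave U).
Proof. by rewrite /bar nf_cls /conv /enter /leave -!lock -!(compA laws). Qed.

Lemma nf_bar2 U V W (f : mor (U ⊗ V) W) :
  nf (bar2 f) = enter W ∘ (f ∘ ((leave U ⊠ leave V) ∘ nunmerge _ _)).
Proof.
rewrite /bar2 nf_cls unnormalize_join /conv /enter /leave -!lock -!(compA laws).
rewrite (tens_comp laws) eqhom_tens -!(compA laws).
have -> : f_equal2 tens (bob_bracketing1 U) (bob_bracketing1 V) =
    etrans (esym (bob_join _ _)) (bob_bracketing2 U V) by apply: Prop_irrelevance.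
by rewrite -eqhom_comp -!(compA laws).
Qed.

Lemma nf_bar_to1 U (f : mor U unit_ob) : nf (bar_to1 f) = f ∘ leave U.
Proof.
by rewrite /bar_to1 nf_cls /conv /leave -!lock /= !(comp1m laws) (compA laws).
Qed.

Definition bar_from1 U (f : mor unit_ob U) : bhom [::] (word1 U) :=
  cls (a := BUnit C) (conv erefl (bob_bracketing1 U) f).

Lemma nf_bar_from1 U (f : mor unit_ob U) : nf (bar_from1 f) = enter U ∘ f.
Proof.
by rewrite /bar_from1 nf_cls /conv /enter -!lock /= !(compm1 laws) (compA laws).
Qed.

(** The mirror image of [merge_assoc], obtained by inverting all arrows but
    [Phi]. *)
Lemma nunmerge_assoc u v w
    (e : normal_ob (u ++ (v ++ w)) = normal_ob ((u ++ v) ++ w)) :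
  Phi _ _ _ ∘ ((idm _ ⊠ nunmerge v w) ∘ nunmerge u (v ++ w)) =
  (nunmerge u v ⊠ idm _) ∘ (nunmerge (u ++ v) w ∘ eqhom e).
Proof.
have -> : Phi (normal_ob u) (normal_ob v) (normal_ob w) =
    (nunmerge u v ⊠ idm _) ∘ (nunmerge (u ++ v) w ∘
      (eqhom e ∘ (nmerge u (v ++ w) ∘ (idm _ ⊠ nmerge v w)))).
  rewrite (compA laws (eqhom e)) -merge_assoc -!(compA laws) nmergeKl.
  by rewrite tens_compl mergeK (comp1m laws) (tens11 laws) (comp1m laws).
rewrite -!(compA laws) tens_compl unmergeK (comp1m laws) (tens11 laws).
by rewrite (comp1m laws) unmergeK (compm1 laws).
Qed.

Lemma nunmerge0 w (e : normal_ob (w ++ [::]) = normal_ob w ⊗ unit_ob) :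
  nunmerge w [::] = eqhom e.
Proof.
rewrite -[RHS](comp1m laws) -(mergeK w [::]) (merge0 (esym e)) -(compA laws) eqhomK.
by rewrite (compm1 laws).
Qed.

End NormalForms.

(** * Strict monoidal structure *)

Section StrictMonoidal.
Variable C : braidedAbCat.
Implicit Types (U V W : C) (u v w : word C).
Let laws := cat_laws C.
Local Open Scope bar_scope.

Ltac to_nf := apply: nf_inj; rewrite ?(nf_comp, nf_tens, nf_add, nf0, nf_id,
  nf_beqhom, nf_bar, nf_bar2, nf_braid, nf_bar_to1, nf_bar_from1).

Lemma bcomp1f v w (f : bhom v w) : bid w ∘ f = f.
Proof. by to_nf; rewrite (comp1m laws). Qed.

Lemma bcompf1 v w (f : bhom v w) : f ∘ bid v = f.
Proof. by to_nf; rewrite (compm1 laws). Qed.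

Lemma bcompA u v w x (h : bhom w x) (g : bhom v w) (f : bhom u v) :
  h ∘ (g ∘ f) = h ∘ g ∘ f.
Proof. by to_nf; rewrite (compA laws). Qed.

Lemma bcompDl u v w (g g' : bhom v w) (f : bhom u v) :
  (g + g') ∘ f = g ∘ f + g' ∘ f.
Proof. by to_nf; rewrite (compDl laws). Qed.

Lemma bcompDr u v w (g : bhom v w) (f f' : bhom u v) :
  g ∘ (f + f') = g ∘ f + g ∘ f'.
Proof. by to_nf; rewrite (compDr laws). Qed.

Lemma bcomp0 u v w (f : bhom u v) : (0 : bhom v w) ∘ f = 0.
Proof. by to_nf; rewrite comp0m. Qed.

Lemma bcompNl u v w (g : bhom v w) (f : bhom u v) : (- g) ∘ f = - (g ∘ f).
Proof.
by apply: (addrI (g ∘ f)); rewrite -bcompDl !subrr bcomp0.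
Qed.

Lemma bcomp_signl u v w (g : bhom v w) (f : bhom u v) i :
  (g *~ (-1) ^+ i) ∘ f = (g ∘ f) *~ (-1) ^+ i.
Proof.
by elim: i => [|i IH]; rewrite ?mulr1z // !exprS !mulN1r !mulrNz bcompNl IH.
Qed.

Lemma btensDr v w v' w' (f : bhom v v') (g g' : bhom w w') :
  f ⊠ (g + g') = f ⊠ g + f ⊠ g'.
Proof.
by to_nf; rewrite (tensDr laws) (compDl laws) (compDr laws).
Qed.

Lemma btens11 v w : bid v ⊠ bid w = bid (v ++ w).
Proof. by to_nf; rewrite (tens11 laws) (comp1m laws) unmergeK. Qed.

Lemma btens_comp v v' v'' w w' w'' (f' : bhom v' v'') (f : bhom v v')
    (g' : bhom w' w'') (g : bhom w w') :
  (f' ∘ f) ⊠ (g' ∘ g) = (f' ⊠ g') ∘ (f ⊠ g).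
Proof.
by to_nf; rewrite -!(compA laws) nmergeKl tens_compl.
Qed.

Lemma beqhom_id v (e : v = v) : beqhom e = bid v.
Proof. by rewrite (Prop_irrelevance e erefl). Qed.

Lemma beqhom_comp u v w (e : u = v) (e' : v = w) :
  beqhom e' ∘ beqhom e = beqhom (etrans e e').
Proof. by case: w / e'; case: v / e; rewrite /= bcomp1f. Qed.

(** Any two proofs of an equality of words agree, so that those on the right
    may be chosen freely, in this lemma and in the next ones. *)
Lemma beqhom_comp_eq u v w (e : u = v) (e' : v = w) (e'' : u = w) :
  beqhom e' ∘ beqhom e = beqhom e''.
Proof. by rewrite beqhom_comp; congr beqhom; apply: Prop_irrelevance. Qed.

Lemma beqhom_conj v v' v'' w w' w'' (f : bhom v w) (e1 : w = w') (e2 : w' = w'')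
    (e3 : w = w'') (e4 : v' = v) (e5 : v'' = v') (e6 : v'' = v) :
  beqhom e2 ∘ (beqhom e1 ∘ f ∘ beqhom e4) ∘ beqhom e5 =
  beqhom e3 ∘ f ∘ beqhom e6.
Proof.
case: w'' / e2 e3 => e3; case: w' / e1 e3 => e3; case: v / e4 f e6 => f e6.
by case: v' / e5 f e6 => f e6; rewrite !beqhom_id !bcomp1f !bcompf1.
Qed.

Lemma btens_beqhomr v v' w w' x x' (f : bhom v v') (g : bhom w w') (e : x = w)
    (e' : w' = x') (e1 : v' ++ w' = v' ++ x') (e2 : v ++ x = v ++ w) :
  f ⊠ (beqhom e' ∘ g ∘ beqhom e) = beqhom e1 ∘ (f ⊠ g) ∘ beqhom e2.
Proof.
case: x' / e' e1 => e1; case: w / e g e2 => g e2.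
by rewrite !beqhom_id !bcomp1f !bcompf1.
Qed.

Lemma btens1f v w (f : bhom v w) : bid [::] ⊠ f = f.
Proof.
to_nf => /=.
by rewrite (compA laws) (id1_tensm laws) -(compA laws) eqhomK (compm1 laws).
Qed.

Lemma btensf1 v w (f : bhom v w) (e : w = w ++ [::]) (e' : v ++ [::] = v) :
  f ⊠ bid [::] = beqhom e ∘ f ∘ beqhom e'.
Proof.
to_nf.
rewrite (merge0 (etrans (tensU1 laws _) (f_equal (@normal_ob C) e))).
rewrite (nunmerge0 (etrans (f_equal (@normal_ob C) e') (esym (tensU1 laws _)))).
rewrite -!eqhom_comp -!(compA laws) (compA laws (eqhom (tensU1 _ _))).
by rewrite (tensm_id1 laws) -(compA laws) eqhomKl.
Qed.

Lemma btensA u u' v v' w w' (f : bhom u u') (g : bhom v v') (h : bhom w w') :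
  beqhom (catA u' v' w') ∘ (f ⊠ (g ⊠ h)) =
  ((f ⊠ g) ⊠ h) ∘ beqhom (catA u v w).
Proof.
to_nf.
have -> : (nf f ⊠ (nmerge v' w' ∘ ((nf g ⊠ nf h) ∘ nunmerge v w)))%C =
    ((idm _ ⊠ nmerge v' w') ∘
      ((nf f ⊠ (nf g ⊠ nf h)) ∘ (idm _ ⊠ nunmerge v w)))%C.
  by rewrite -!(tens_comp laws) (comp1m laws) (compm1 laws).
have -> : ((nmerge u' v' ∘ ((nf f ⊠ nf g) ∘ nunmerge u v)) ⊠ nf h)%C =
    ((nmerge u' v' ⊠ idm _) ∘
      (((nf f ⊠ nf g) ⊠ nf h) ∘ (nunmerge u v ⊠ idm _)))%C.
  by rewrite -!(tens_comp laws) (comp1m laws) (compm1 laws).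
rewrite -!(compA laws) -nunmerge_assoc (compA laws (_ ⊠ nf h)%C).
rewrite -(Phi_nat laws) !(compA laws) -(merge_assoc (f_equal _ (catA u' v' w'))).
by [].
Qed.

Lemma btensA_eq u u' v v' w w' (f : bhom u u') (g : bhom v v') (h : bhom w w')
    (e' : (u' ++ v') ++ w' = u' ++ (v' ++ w')) (e : u ++ (v ++ w) = (u ++ v) ++ w) :
  f ⊠ (g ⊠ h) = beqhom e' ∘ ((f ⊠ g) ⊠ h) ∘ beqhom e.
Proof.
rewrite (Prop_irrelevance e (catA u v w)) -bcompA -btensA bcompA beqhom_comp.
by rewrite beqhom_id bcomp1f.
Qed.

Lemma bar1 U : bar (idm U) = bid (word1 U).
Proof. by to_nf; rewrite (comp1m laws) leaveK. Qed.

Lemma bar0 U V : bar (0 : mor U V) = 0.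
Proof. by to_nf; rewrite comp0m compm0. Qed.

Lemma bar_to1_0 U : bar_to1 (0 : mor U unit_ob) = 0.
Proof. by to_nf; rewrite comp0m. Qed.

Lemma bar_comp U V W (g : mor V W) (f : mor U V) :
  bar g ∘ bar f = bar (g ∘ f)%C.
Proof. by to_nf; rewrite -!(compA laws) enterKl. Qed.

Lemma bar_bar2 U V W X (d : mor W X) (m : mor (U ⊗ V)%C W) :
  bar d ∘ bar2 m = bar2 (d ∘ m)%C.
Proof. by to_nf; rewrite -!(compA laws) enterKl. Qed.

Lemma bar_to1_bar U V (f : mor V unit_ob) (g : mor U V) :
  bar_to1 f ∘ bar g = bar_to1 (f ∘ g)%C.
Proof. by to_nf; rewrite -!(compA laws) enterKl. Qed.

Lemma bar2_tens U V U' V' W (m : mor (U ⊗ V)%C W) (f : mor U' U) (g : mor V' V) :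
  bar2 m ∘ (bar f ⊠ bar g) = bar2 (m ∘ (f ⊠ g))%C.
Proof.
by to_nf; rewrite -!(compA laws) nmergeKl !tens_compl !enterKl.
Qed.

Lemma bar2D U V W (m m' : mor (U ⊗ V)%C W) : bar2 (m + m') = bar2 m + bar2 m'.
Proof. by to_nf; rewrite (compDl laws) (compDr laws). Qed.

Fact bcomp_zmod u v w (g : bhom v w) : zmod_morphism (@bcomp C u v w g).
Proof.
by move=> f f'; apply: (addIr (g ∘ f')); rewrite -bcompDr !subrK.
Qed.
HB.instance Definition _ u v w (g : bhom v w) :=
  GRing.isZmodMorphism.Build _ _ (@bcomp C u v w g) (bcomp_zmod g).

Fact bar2_zmod U V W : zmod_morphism (@bar2 C U V W).
Proof. by move=> f g; apply: (addIr (bar2 g)); rewrite -bar2D !subrK. Qed.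
HB.instance Definition _ U V W :=
  GRing.isZmodMorphism.Build _ _ (@bar2 C U V W) (@bar2_zmod U V W).

(** * Products of generalized elements *)

(** The product of the generalized elements f and g along m. The variables of
    f come first, then those of g. *)
Definition gmul U V W (m : mor (U ⊗ V)%C W) u v (f : bhom u (word1 U))
    (g : bhom v (word1 V)) : bhom (u ++ v) (word1 W) := locked (bar2 m ∘ (f ⊠ g)).

Lemma nf_gmul U V W (m : mor (U ⊗ V)%C W) u v (f : bhom u (word1 U))
    (g : bhom v (word1 V)) :
  nf (gmul m f g) = (enter W ∘ (m ∘
    (((leave U ∘ nf f) ⊠ (leave V ∘ nf g)) ∘ nunmerge u v)))%C.
Proof.
rewrite /gmul -!lock nf_comp nf_tens nf_bar2 -!(compA laws).
by rewrite nmergeKl tens_compl.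
Qed.

(** The hypothesis is an equation of C with an explicit [Phi]; after passing
    to words, [Phi] is absorbed by the associativity of concatenation. *)
Lemma gmulA U V W X Y Z (m1 : mor (V ⊗ W)%C X) (m2 : mor (U ⊗ X)%C Z)
    (m3 : mor (U ⊗ V)%C Y) (m4 : mor (Y ⊗ W)%C Z) u v w
    (f : bhom u (word1 U)) (g : bhom v (word1 V)) (h : bhom w (word1 W)) :
  (m2 ∘ (idm U ⊠ m1) = m4 ∘ (m3 ⊠ idm W) ∘ Phi U V W)%C ->
  gmul m2 f (gmul m1 g h) = gmul m4 (gmul m3 f g) h ∘ beqhom (catA u v w).
Proof.
move=> mA; apply: nf_inj; rewrite nf_comp !nf_gmul nf_beqhom !enterKl.
move: (leave U ∘ nf f)%C (leave V ∘ nf g)%C (leave W ∘ nf h)%C => a b c.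
have -> : (a ⊠ (m1 ∘ ((b ⊠ c) ∘ nunmerge v w)))%C =
    ((idm U ⊠ m1) ∘ ((a ⊠ (b ⊠ c)) ∘ (idm _ ⊠ nunmerge v w)))%C.
  by rewrite -!(tens_comp laws) (comp1m laws) (compm1 laws).
have -> : ((m3 ∘ ((a ⊠ b) ∘ nunmerge u v)) ⊠ c)%C =
    ((m3 ⊠ idm W) ∘ (((a ⊠ b) ⊠ c) ∘ (nunmerge u v ⊠ idm _)))%C.
  by rewrite -!(tens_comp laws) (comp1m laws) (compm1 laws).
rewrite -!(compA laws) -nunmerge_assoc (compA laws m2) mA -!(compA laws).
by rewrite (compA laws (Phi U V W)) (Phi_nat laws) -!(compA laws).
Qed.

Lemma gmul_unitr U V (m : mor (U ⊗ V)%C U) (eta : mor unit_ob V) u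
    (f : bhom u (word1 U)) :
  (m ∘ (idm U ⊠ eta) = eqhom (tensU1 laws U))%C ->
  gmul m f (bar_from1 eta) = f ∘ beqhom (cats0 u).
Proof.
move=> m1; apply: nf_inj; rewrite nf_comp nf_gmul nf_beqhom nf_bar_from1 enterKl.
rewrite -[X in (X ⊠ _)%C](comp1m laws) -[X in (_ ⊠ X)%C](compm1 laws).
rewrite (tens_comp laws) -!(compA laws) (compA laws m) m1 (compA laws (eqhom _)).
rewrite (tensm_id1 laws).
rewrite -!(compA laws) (compA laws (enter U)) leaveK (comp1m laws).
rewrite (nunmerge0 (etrans (f_equal (@normal_ob C) (cats0 u))
  (esym (tensU1 laws _)))).
by rewrite eqhom_comp; congr (_ ∘ eqhom _)%C; apply: Prop_irrelevance.
Qed.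

Lemma gmul_unitl U V (m : mor (V ⊗ U)%C U) (eta : mor unit_ob V) u
    (f : bhom u (word1 U)) :
  (m ∘ (eta ⊠ idm U) = eqhom (tens1U laws U))%C ->
  gmul m (bar_from1 eta) f = f.
Proof.
move=> m1; apply: nf_inj; rewrite nf_gmul nf_bar_from1 enterKl.
rewrite -[X in (_ ⊠ X)%C](comp1m laws) -[X in (X ⊠ _)%C](compm1 laws).
rewrite (tens_comp laws) -!(compA laws) (compA laws m) m1 (compA laws (eqhom _)).
by rewrite (id1_tensm laws) -!(compA laws) (compA laws (enter U)) leaveK
  (comp1m laws) eqhomK (compm1 laws).
Qed.

Lemma gmul_comp U V W (m : mor (U ⊗ V)%C W) u v u' v' (f : bhom u (word1 U))
    (g : bhom v (word1 V)) (f' : bhom u' u) (g' : bhom v' v) :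
  gmul m f g ∘ (f' ⊠ g') = gmul m (f ∘ f') (g ∘ g').
Proof. by rewrite /gmul -!lock btens_comp bcompA. Qed.

Lemma gmulDr U V W (m : mor (U ⊗ V)%C W) u v (f : bhom u (word1 U))
    (g g' : bhom v (word1 V)) :
  gmul m f (g + g') = gmul m f g + gmul m f g'.
Proof. by rewrite /gmul -!lock btensDr bcompDr. Qed.

Fact gmul_zmod U V W (m : mor (U ⊗ V)%C W) u v (f : bhom u (word1 U)) :
  zmod_morphism (@gmul U V W m u v f).
Proof.
by move=> g g'; apply: (addIr (gmul m f g')); rewrite -gmulDr !subrK.
Qed.
HB.instance Definition _ U V W (m : mor (U ⊗ V)%C W) u v (f : bhom u (word1 U)) :=
  GRing.isZmodMorphism.Build _ _ (@gmul U V W m u v f) (@gmul_zmod U V W m u v f).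

Lemma gmul_beqhoml U V W (m : mor (U ⊗ V)%C W) u v u' (f : bhom u (word1 U))
    (g : bhom v (word1 V)) (e : u' = u) (e2 : u' ++ v = u ++ v) :
  gmul m (f ∘ beqhom e) g = gmul m f g ∘ beqhom e2.
Proof. by case: u / e f e2 => f e2; rewrite !beqhom_id !bcompf1. Qed.

Lemma gmul_beqhomr U V W (m : mor (U ⊗ V)%C W) u v v' (f : bhom u (word1 U))
    (g : bhom v (word1 V)) (e : v' = v) (e2 : u ++ v' = u ++ v) :
  gmul m f (g ∘ beqhom e) = gmul m f g ∘ beqhom e2.
Proof. by case: v / e g e2 => g e2; rewrite !beqhom_id !bcompf1. Qed.

End StrictMonoidal.

(** * Face morphisms *)

Section Faces.
Variables (C : braidedAbCat) (A : ribbonAlgebra C).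
Local Open Scope bar_scope.

Lemma inner_face0 k : inner_face A (ord0 : 'I_k.+1) = mul_first A k.
Proof.
rewrite /inner_face btens1f /=.
move: (wpow_split _ _ _) (wpow_split _ _ _) => /=; rewrite subn0 => e1 e2.
by rewrite !beqhom_id bcomp1f bcompf1.
Qed.

Lemma inner_faceS k (i : 'I_k.+1) :
  inner_face A (lift ord0 i) = bid (word1 A) ⊠ inner_face A i.
Proof.
rewrite /inner_face.
rewrite (btens_beqhomr _ _ _ _ (f_equal (cat _) (esym (wpow_split A 1 (ltn_ord i))))
  (f_equal (cat _) (wpow_split A 2 (ltn_ord i)))).
rewrite (btensA_eq _ _ _ (esym (catA _ _ _)) (catA _ _ _)) btens11.
by rewrite (beqhom_conj _ _ _ (esym (wpow_split A 1 (ltn_ord (lift ord0 i))))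
  _ _ (wpow_split A 2 (ltn_ord (lift ord0 i)))).
Qed.

End Faces.

(** * The forms a_0 da_1 ... da_k *)

Section Calculus.
Variables (C : braidedAbCat) (A : ribbonAlgebra C) (n : nat) (Om : diffCalculus A n).
Local Open Scope bar_scope.

Local Notation a := (bid (word1 A) : bhom (word1 A) (word1 (dc_ob Om 0))).
Local Notation da := (bar (dc_d Om (erefl 1%N))).
Local Notation d k := (bcomp (bar (dc_d Om (erefl k.+1)))).

Lemma leibniz i j k i' j' k' (e : (i + j)%N = k)
      (ei : i.+1 = i') (ej : j.+1 = j') (ek : k.+1 = k')
      (el : (i' + j)%N = k') (er : (i + j')%N = k') u v
      (f : bhom u (word1 (dc_ob Om i))) (g : bhom v (word1 (dc_ob Om j))) :
  (k' <= n)%N ->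
  bar (dc_d Om ek) ∘ gmul (dc_mul Om e) f g =
  gmul (dc_mul Om el) (bar (dc_d Om ei) ∘ f) g +
  gmul (dc_mul Om er) f (bar (dc_d Om ej) ∘ g) *~ (-1) ^+ i.
Proof.
move=> le_n; rewrite /gmul -!lock bcompA bar_bar2.
rewrite (dc_leibniz Om e ei ej ek el er le_n) raddfD raddfMz /= -!bar2_tens.
by rewrite !bar1 bcompDl bcomp_signl -!bcompA -!btens_comp !bcomp1f.
Qed.

Lemma dc_gmulA i j k ij jk l (e1 : (i + j)%N = ij) (e2 : (ij + k)%N = l)
    (e3 : (j + k)%N = jk) (e4 : (i + jk)%N = l) u v w
    (f : bhom u (word1 (dc_ob Om i))) (g : bhom v (word1 (dc_ob Om j)))
    (h : bhom w (word1 (dc_ob Om k))) : (l <= n)%N ->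
  gmul (dc_mul Om e4) f (gmul (dc_mul Om e3) g h) =
  gmul (dc_mul Om e2) (gmul (dc_mul Om e1) f g) h ∘ beqhom (catA u v w).
Proof. by move=> le_n; apply/gmulA/dc_assoc. Qed.

Lemma bar_dd i j k (e1 : i.+1 = j) (e2 : j.+1 = k) : (k <= n)%N ->
  bar (dc_d Om e2) ∘ bar (dc_d Om e1) = 0.
Proof.
by move=> le_n; rewrite bar_comp dc_dd ?bar0.
Qed.

Definition form k : bhom (wpow A k.+1) (word1 (dc_ob Om k)) :=
  locked (dc_prod Om k ∘ (bid (word1 A) ⊠ dc_dpow Om k)).

(** The factors d of [dc_dpow] are added on the left, whereas [dc_prod]
    multiplies from the left and thus peels off its last factor. *)
Lemma dpow_snoc k :
  dc_dpow Om k.+1 = beqhom (esym (wpowSr _ k)) ∘ (dc_dpow Om k ⊠ da)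
    ∘ beqhom (wpowSr A k).
Proof.
elim: k => [|k IH].
  by rewrite /= (btensf1 _ (esym (wpowSr _ 0)) (wpowSr A 0)) btens1f.
rewrite -[LHS]/(da ⊠ dc_dpow Om k.+1) [in LHS]IH.
rewrite (btens_beqhomr _ _ _ _ (f_equal (cat _) (esym (wpowSr _ k)))
  (f_equal (cat _) (wpowSr A k))).
rewrite (btensA_eq _ _ _ (esym (catA _ _ _)) (catA _ _ _)).
exact: beqhom_conj.
Qed.

Lemma form0 : form 0 = beqhom (cats0 (word1 A)).
Proof. by rewrite /form -!lock /= btens11 bcompf1. Qed.

Lemma form_snoc k :
  form k.+1 = gmul (dc_mul Om (addn1 k)) (form k) da ∘ beqhom (wpowSr A k.+1).
Proof.
rewrite /form -!lock dpow_snoc.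
rewrite (btens_beqhomr _ _ _ _ (f_equal (cat _) (esym (wpowSr _ k)))
  (f_equal (cat _) (wpowSr A k))).
rewrite (btensA_eq _ _ _ (esym (catA _ _ _)) (catA _ _ _)).
rewrite (beqhom_conj _ _ _ (esym (wpow_snoc Om k)) _ _ (wpowSr A k.+1)) /=.
rewrite -!bcompA (bcompA (beqhom _) (beqhom _)) beqhom_comp beqhom_id bcomp1f.
by rewrite (bcompA (_ ⊠ _)) -btens_comp bcomp1f /gmul -!lock !bcompA.
Qed.

(** By induction, in the order (a_0 dω_k) da = a_0 (dω_k da) = a_0 d(ω_k da);
    the other term of the Leibniz rule for ω_k da contains dda = 0. *)
Lemma form_cons k : (k < n)%N ->
  form k.+1 = gmul (dc_mul Om (add0n k.+1)) a (d k (form k)).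
Proof.
elim: k => [|k IH] lt_kn.
  rewrite form_snoc form0 -[beqhom (cats0 _)]bcomp1f.
  rewrite (gmul_beqhoml _ _ _ _ (f_equal (cat^~ _) (cats0 (word1 A)))).
  rewrite bcompA (gmul_beqhomr _ _ _ _ (f_equal (cat _) (cats0 (word1 A)))).
  rewrite bcompf1 (Prop_irrelevance (addn1 0) (add0n 1)) -bcompA beqhom_comp.
  by congr (_ ∘ beqhom _); apply: Prop_irrelevance.
rewrite form_snoc [in LHS]IH ?(ltnW lt_kn) //.
rewrite [form k.+1 in RHS]form_snoc bcompA.
rewrite (leibniz (addn1 k) (erefl k.+1) (erefl 2%N) _ (addn1 k.+1) (addn2 k)) //.
rewrite bar_dd; last by apply: leq_trans lt_kn.
rewrite raddf0 mul0rz addr0.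
rewrite (gmul_beqhomr _ _ _ _ (f_equal (cat _) (wpowSr A k.+1))).
rewrite (dc_gmulA (add0n k.+1) (addn1 k.+1)) // -bcompA.
by rewrite (beqhom_comp_eq _ _ (wpowSr A k.+2)).
Qed.

(** For k > 0, multiply the first two factors in a_0 (a_1 dω_(k-1)). *)
Lemma form_mul_first k : (k <= n)%N ->
  form k ∘ mul_first A k = gmul (dc_mul Om (add0n k)) a (form k).
Proof.
case: k => [|k] le_kn.
  rewrite form0 /mul_first (btensf1 _ (esym (cats0 _)) (cats0 _)).
  rewrite !bcompA beqhom_comp beqhom_id bcomp1f -bcompA beqhom_comp.
  rewrite -[beqhom (cats0 _) in RHS]bcomp1f.
  rewrite (gmul_beqhomr _ _ _ _ (f_equal (cat _) (cats0 (word1 A)))).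
  rewrite dc_mul00 /gmul -!lock btens11 bcompf1.
  by congr (_ ∘ beqhom _); apply: Prop_irrelevance.
rewrite form_cons // (dc_gmulA (add0n 0) (add0n k.+1)) //.
rewrite /mul_first bcompA dc_mul00 gmul_comp bcompf1.
by rewrite /gmul -!lock btens11 bcomp1f bcompf1.
Qed.

(** By induction through ω_(k+1) = a_0 dω_k. The face 0 of ω_(k+1) is
    a_0 ω_(k+1). The face i + 1 is a_0 d of the face i of ω_k, so those faces
    add up to - (-1)^k a_0 d(ω_k a). The part of d(ω_k a) in which d hits a is
    (-1)^k ω_k da = (-1)^k ω_(k+1), which cancels the face 0, and the other part
    leaves (-1)^(k+1) a_0 dω_k a. *)
Lemma inner_faces_sum k : (k <= n)%N ->
  \sum_(i < k.+1) (form k ∘ inner_face A i) *~ (-1) ^+ i =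
  (gmul (dc_mul Om (addn0 k)) (form k) a ∘ beqhom (wpowSr A k.+1)) *~ (-1) ^+ k.
Proof.
elim: k => [|k IH] le_kn.
  rewrite big_ord1 inner_face0 form_mul_first // form0 !mulr1z.
  rewrite -[beqhom (cats0 _)]bcomp1f.
  rewrite (gmul_beqhoml _ _ _ _ (f_equal (cat^~ _) (cats0 (word1 A)))).
  rewrite (gmul_beqhomr _ _ _ _ (f_equal (cat _) (cats0 (word1 A)))).
  rewrite -[RHS]bcompA beqhom_comp (Prop_irrelevance (addn0 0) (add0n 0)).
  by congr (_ ∘ beqhom _); apply: Prop_irrelevance.
rewrite big_ord_recl inner_face0 form_mul_first // mulr1z.
set s := \sum_(i < _) _.
have -> : s = - gmul (dc_mul Om (add0n k.+1)) a
    (d k (\sum_(i < k.+1) (form k ∘ inner_face A i) *~ (-1) ^+ i)).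
  rewrite !raddf_sum; apply: eq_bigr => i _.
  rewrite inner_faceS form_cons // gmul_comp bcompf1 -bcompA.
  by rewrite exprS mulN1r mulrNz !raddfMz.
rewrite {}IH ?(ltnW le_kn) // raddfMz /= bcompA.
rewrite (leibniz (addn0 k) (erefl k.+1) (erefl 1%N) _ (addn0 k.+1) (addn1 k)) //.
rewrite bcompf1 bcompDl bcomp_signl -form_snoc.
rewrite mulrzDl -mulrzA -exprMn mulrNN mulr1 expr1n mulr1z.
rewrite raddfD raddfMz /= opprD addrCA subrr addr0.
rewrite (gmul_beqhomr _ _ _ _ (f_equal (cat _) (wpowSr A k.+1))).
rewrite (dc_gmulA (add0n k.+1) (addn0 k.+1) (addn0 k.+1)) // -bcompA.
rewrite (beqhom_comp_eq _ _ (wpowSr A k.+2)) -form_cons //.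
by rewrite exprS mulN1r mulrNz.
Qed.

(** * The cocycle *)

(** Written as ∫ m (σ ⊗ id) (id ⊗ w) Ψ, the left side becomes
    ∫ m (σ ⊗ id) Ψ (w ⊗ id) by naturality of the braiding, and the trace property
    applies. *)
Lemma trace_rotation (int : mor (dc_ob Om n) unit_ob) v
    (w : bhom v (word1 (dc_ob Om n))) :
  weak_ribbon_graded_trace int ->
  bar_to1 int ∘ gmul (dc_mul Om (add0n n)) a w ∘ (bar (sigma A) ⊠ bid v)
    ∘ bbraid v (word1 A) =
  bar_to1 int ∘ gmul (dc_mul Om (addn0 n)) w a.
Proof.
move=> int_trace; have laws := cat_laws C.
rewrite -(bcompA (bar_to1 int)) gmul_comp bcomp1f bcompf1.
apply: nf_inj; rewrite !nf_comp nf_braid !nf_gmul nf_bar_to1 nf_bar nf_id.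
rewrite (compm1 laws) -!(compA laws) !enterKl nmergeKl.
have -> : ((sigma A ∘ leave A) ⊠ (leave (dc_ob Om n) ∘ nf w))%C =
    ((sigma A ⊠ idm _) ∘ (leave A ⊠ (leave (dc_ob Om n) ∘ nf w)))%C.
  by rewrite -(tens_comp laws) (comp1m laws).
rewrite -!(compA laws) (compA laws (leave A ⊠ _)%C) -(Psi_nat laws) !(compA laws).
by rewrite int_trace.
Qed.

Lemma form_hochschild (int : mor (dc_ob Om n) unit_ob) :
  weak_ribbon_graded_trace int -> hochschild (bar_to1 int ∘ form n) = 0.
Proof.
move=> int_trace.
rewrite /hochschild big_ord_recr /= /face unlift_none.
under eq_bigr => i _.
  rewrite (_ : widen_ord _ i = lift ord_max i); last first.
    by apply: val_inj; rewrite /= /bump leqNgt ltn_ord.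
  rewrite liftK -bcompA -raddfMz; over.
rewrite -raddf_sum inner_faces_sum // /last_face -(bcompA (bar_to1 int)).
rewrite (bcompA (form n)) form_mul_first // /rotation !bcompA.
rewrite trace_rotation // raddfMz /= bcompA.
by rewrite exprS mulN1r mulrNz subrr.
Qed.

(** ∫ d(ω_k a) = 0, expanded by the Leibniz rule. *)
Lemma closed_form_mul k (int : mor (dc_ob Om k.+1) unit_ob) :
  (k < n)%N -> (int ∘ dc_d Om (erefl k.+1))%C = 0 ->
  bar_to1 int ∘ gmul (dc_mul Om (addn0 k.+1)) (d k (form k)) a =
  - ((bar_to1 int ∘ gmul (dc_mul Om (addn1 k)) (form k) da) *~ (-1) ^+ k).
Proof.
move=> lt_kn int_closed.
have := leibniz (addn0 k) (erefl k.+1) (erefl 1%N) (erefl k.+1)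
  (addn0 k.+1) (addn1 k) (form k) a lt_kn.
move/(f_equal (bcomp (bar_to1 int))); rewrite bcompA bar_to1_bar int_closed.
rewrite bar_to1_0 bcomp0 bcompf1 bcompDr raddfMz /= => /esym/eqP.
by rewrite addr_eq0 => /eqP.
Qed.

End Calculus.

Local Open Scope bar_scope.

Lemma form_cyclic (C : braidedAbCat) (A : ribbonAlgebra C) (n : nat)
    (Om : diffCalculus A n) (int : mor (dc_ob Om n) unit_ob) :
  weak_ribbon_graded_trace int -> closed_trace int ->
  C_lambda (bar_to1 int ∘ form Om n).
Proof.
rewrite /C_lambda /lambda raddfMz /= /rotation.
case: n Om int => [|k] Om int int_trace int_closed.
  rewrite mulr1z form0 !bcompA.
  (* ω_0 = a η, and a η has the shape that the trace property asks for. *)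
  have {1}-> : bar_to1 int ∘ beqhom (cats0 (word1 A)) = bar_to1 int ∘
      gmul (dc_mul Om (add0n 0)) (bid (word1 A)) (bar_from1 (alg_eta A)).
    by rewrite (gmul_unitr _ (dc_unitr _ _ _)) ?bcomp1f.
  rewrite trace_rotation // (gmul_unitl _ (dc_unitl _ _ _)) // -bcompA bcomp1f.
  by congr (_ ∘ beqhom _); apply: Prop_irrelevance.
rewrite {1}form_cons // (bcompA (_ ∘ gmul _ _ _)) (bcompA (_ ∘ gmul _ _ _)).
rewrite trace_rotation // closed_form_mul // form_snoc bcompA.
rewrite bcompNl bcomp_signl exprS mulN1r mulrNz mulNrz opprK.
by rewrite -mulrzA -exprMn mulrNN mulr1 expr1n mulr1z.
Qed.

Theorem theorem8 (C : braidedAbCat) (A : ribbonAlgebra C) (n : nat)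
    (Om : diffCalculus A n) (int : mor (dc_ob Om n) unit_ob) :
  weak_ribbon_graded_trace int -> closed_trace int ->
  Z_lambda (dc_character int).
Proof.
move=> int_trace int_closed.
have -> : dc_character int = bar_to1 int ∘ form Om n.
  by rewrite /dc_character /form -!lock -bcompA.
by split; [exact: form_cyclic | exact: form_hochschild].
Qed.
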